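(* Let $A \in \mathbb{R}^{m \times n}$ be an entrywise nonnegative matrix. The following three quantities are all equal (and equal to $\nu_+(A)$, which is by definition the quantity (iii)): (i) $\displaystyle\min \left\{ \sum_{i} \|u_i\|_2 \|v_i\|_2 \; : \; A = \sum_{i} u_i v_i^{T}, \; u_i\in\mathbb{R}^m,\ v_i\in\mathbb{R}^n \text{ entrywise nonnegative} \right\}$, over all finite decompositions of this form; (ii) $\displaystyle\min_{X,Y} \left\{ \frac{1}{2}(\operatorname{trace}(X)+\operatorname{trace}(Y)) \; : \; \begin{bmatrix} X & A\\ A^{T} & Y \end{bmatrix} \text{ is completely positive} \right\}$, where $X$ and $Y$ range over real symmetric matrices of size $m$ and $n$ respectively; (iii) $\displaystyle\max_{W \in \mathbb{R}^{m \times n}} \left\{ \langle A, W \rangle \; : \; \begin{bmatrix} I & -W\\ -W^{T} & I \end{bmatrix} \text{ is copositive} \right\}$.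
   Context: A symmetric matrix $M \in \mathbb{R}^{N\times N}$ is copositive if $x^{T} M x \geq 0$ for all entrywise nonnegative $x\in \mathbb{R}^{N}$. A symmetric matrix $M$ is completely positive if $M=BB^{T}$ for some entrywise nonnegative matrix $B$ (with any finite number of columns). $\langle X,Y\rangle = \operatorname{trace}(X^{T}Y)$, and $\|\cdot\|_2$ is the Euclidean norm. In (iii), $\max$ denotes the optimal value of the program, i.e. the supremum of the objective over the feasible set. *)

(* Defs.v *)
From mathcomp Require Import all_boot all_order all_algebra.
From mathcomp Require Import boolp classical_sets reals.

Set Implicit Arguments.
Unset Strict Implicit.
Unset Printing Implicit Defensive.

Import Order.TTheory GRing.Theory Num.Theory.

Local Open Scope classical_set_scope.
Local Open Scope ring_scope.

(* The canonical norm on matrices in MathComp-Analysis is the sup norm, hence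
   this separate Euclidean norm. *)
Definition l2norm (R : realType) (n : nat) (u : 'cV[R]_n) : R :=
  Num.sqrt (\sum_(i < n) u i 0 ^+ 2).

Definition frobenius_dot (R : realType) (m n : nat) (X Y : 'M[R]_(m, n)) : R :=
  \tr (X^T *m Y).

Definition copositive (R : realType) (N : nat) (M : 'M[R]_N) : Prop :=
  M \is symmetricmx /\
  forall x : 'cV[R]_N, x \is a mxOver Num.nneg -> 0 <= (x^T *m M *m x) 0 0.

Definition completely_positive (R : realType) (N : nat) (M : 'M[R]_N) : Prop :=
  M \is symmetricmx /\
  exists (k : nat) (B : 'M[R]_(N, k)), B \is a mxOver Num.nneg /\ M = B *m B^T.

Definition is_min (R : realType) (S : set R) (c : R) : Prop :=
  S c /\ lbound S c.

Definition decomposition_values (R : realType) (m n : nat) (A : 'M[R]_(m, n)) :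
    set R :=
  [set c | exists (k : nat) (u : 'I_k -> 'cV[R]_m) (v : 'I_k -> 'cV[R]_n),
     [/\ forall i, u i \is a mxOver Num.nneg,
         forall i, v i \is a mxOver Num.nneg,
         A = \sum_(i < k) u i *m (v i)^T
       & c = \sum_(i < k) l2norm (u i) * l2norm (v i)]].

Definition completely_positive_values (R : realType) (m n : nat)
    (A : 'M[R]_(m, n)) : set R :=
  [set c | exists (X : 'M[R]_m) (Y : 'M[R]_n),
     [/\ X \is symmetricmx,
         Y \is symmetricmx,
         completely_positive (block_mx X A A^T Y)
       & c = 2^-1 * (\tr X + \tr Y)]].

Definition copositive_values (R : realType) (m n : nat) (A : 'M[R]_(m, n)) :
    set R :=
  [set frobenius_dot A W | W in
     [set W : 'M[R]_(m, n) | copositive (block_mx 1%:M (- W) (- W^T) 1%:M)]].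

(* [sup] is 0 by convention on a set that is empty or unbounded above, so this
   is the genuine supremum only together with [has_sup (copositive_values A)]. *)
Definition nu_plus (R : realType) (m n : nat) (A : 'M[R]_(m, n)) : R :=
  sup (copositive_values A).

(* Main.v *)
Require Import Defs.
From mathcomp Require Import all_boot all_order all_algebra.
From mathcomp Require Import boolp classical_sets reals.
From mathcomp Require Import topology normedtype derive.
From mathcomp Require Import ring lra.

(* Pairing a completely positive [[X, A], [A^T, Y]] with a copositive
   [[I, -W], [-W^T, I]] gives 2 <A, W> <= tr X + tr Y, so (iii) <= (ii), and
   rescaling the vectors gives (iii) <= (i). Conversely, put c = 2 nu_+(A). The
   completely positive matrices of trace at most c form a convex set, which is
   compact because, by Caratheodory's theorem, each of them has a nonnegative
   factor with a bounded number of columns. Let P be the residual A - A' for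
   the off-diagonal block A' nearest to A. If P <> 0, the variational inequality
   at A' makes a positive multiple W of P feasible for (iii) with
   <A, W> > nu_+(A), which is absurd. So A' = A, and a factor of the nearest
   matrix is optimal in (i) and in (ii). *)

Set Implicit Arguments.
Unset Strict Implicit.
Unset Printing Implicit Defensive.

Import Order.TTheory GRing.Theory Num.Theory.
Import numFieldNormedType.Exports.
Local Open Scope ring_scope.

(** * The trace inner product on real matrices *)

Section FrobeniusDot.
Variables (R : realType) (m n : nat).
Implicit Types X Y Z : 'M[R]_(m, n).

Lemma frobenius_dotE X Y :
  frobenius_dot X Y = \sum_i \sum_j X i j * Y i j.
Proof.
rewrite /frobenius_dot /mxtrace exchange_big; apply: eq_bigr => j _.
by rewrite mxE; apply: eq_bigr => i _; rewrite mxE.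
Qed.

Lemma frobenius_dotC X Y : frobenius_dot X Y = frobenius_dot Y X.
Proof.
rewrite !frobenius_dotE; apply: eq_bigr => i _; apply: eq_bigr => j _.
exact: mulrC.
Qed.

Lemma frobenius_dotDr X Y Z :
  frobenius_dot X (Y + Z) = frobenius_dot X Y + frobenius_dot X Z.
Proof. by rewrite /frobenius_dot mulmxDr mxtraceD. Qed.

Lemma frobenius_dotZr a X Y : frobenius_dot X (a *: Y) = a * frobenius_dot X Y.
Proof. by rewrite /frobenius_dot -scalemxAr mxtraceZ. Qed.

Lemma frobenius_dotBr X Y Z :
  frobenius_dot X (Y - Z) = frobenius_dot X Y - frobenius_dot X Z.
Proof. by rewrite frobenius_dotDr -scaleN1r frobenius_dotZr mulN1r. Qed.

Lemma frobenius_dot_ge0 X : 0 <= frobenius_dot X X.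
Proof.
rewrite frobenius_dotE; apply: sumr_ge0 => i _; apply: sumr_ge0 => j _.
exact: sqr_ge0.
Qed.

Lemma frobenius_dot_eq0 X : frobenius_dot X X = 0 -> X = 0.
Proof.
rewrite frobenius_dotE => X0; apply/matrixP => i j; rewrite mxE.
have row0 : \sum_j X i j * X i j = 0.
  apply: (psumr_eq0P _ X0) => // k _.
  by apply: sumr_ge0 => l _; exact: sqr_ge0.
have := psumr_eq0P (fun l _ => sqr_ge0 (X i l)) row0 => /(_ j isT)/eqP.
by rewrite mulf_eq0 orbb => /eqP.
Qed.

End FrobeniusDot.

(** * The completely positive cone and its Caratheodory bound *)

Section CompletelyPositive.
Variable R : realType.

Lemma symmetricmxE N (M : 'M[R]_N) : (M \is symmetricmx) = (M == M^T).
Proof.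
by rewrite is_hermitianmxE expr0 scale1r (_ : map_mx _ _ = M^T) //;
  apply/matrixP => i j; rewrite !mxE.
Qed.

Lemma symmetricmxMtr N k (B : 'M[R]_(N, k)) : B *m B^T \is symmetricmx.
Proof. by rewrite symmetricmxE trmx_mul trmxK. Qed.

Lemma completely_positiveMtr N k (B : 'M[R]_(N, k)) :
  B \is a mxOver Num.nneg -> completely_positive (B *m B^T).
Proof. by move=> B0; split; [exact: symmetricmxMtr|exists k, B]. Qed.

Lemma completely_positive0 N : completely_positive (0 : 'M[R]_N).
Proof.
rewrite -(mul0mx N (0 : 'M[R]_N)^T); apply: completely_positiveMtr.
by apply: mxOver0; rewrite nnegrE.
Qed.

Lemma mxOver_row_mx N k l (S : {pred R}) (B : 'M[R]_(N, k)) (C : 'M[R]_(N, l)) :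
  B \is a mxOver S -> C \is a mxOver S -> row_mx B C \is a mxOver S.
Proof.
move=> /mxOverP BS /mxOverP CS; apply/mxOverP => i j.
by rewrite mxE; case: splitP.
Qed.

Lemma mxOver_col_mx N k l (S : {pred R}) (B : 'M[R]_(k, N)) (C : 'M[R]_(l, N)) :
  B \is a mxOver S -> C \is a mxOver S -> col_mx B C \is a mxOver S.
Proof.
move=> /mxOverP BS /mxOverP CS; apply/mxOverP => i j.
by rewrite mxE; case: splitP.
Qed.

(** Placing the two factors side by side adds their Gram matrices. *)
Lemma completely_positiveD N (G H : 'M[R]_N) :
  completely_positive G -> completely_positive H -> completely_positive (G + H).
Proof.
move=> [_ [k [B [B0 ->]]]] [_ [l [C [C0 ->]]]].
rewrite -mul_row_col -tr_row_mx.
exact/completely_positiveMtr/mxOver_row_mx.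
Qed.

Lemma completely_positiveZ N a (G : 'M[R]_N) : 0 <= a ->
  completely_positive G -> completely_positive (a *: G).
Proof.
move=> a0 [_ [k [B [B0 ->]]]].
have -> : a *: (B *m B^T) = (Num.sqrt a *: B) *m (Num.sqrt a *: B)^T.
  by rewrite linearZ /= -scalemxAl -scalemxAr scalerA -expr2 sqr_sqrtr.
by apply: completely_positiveMtr; rewrite mxOverZ // nnegrE sqrtr_ge0.
Qed.

Lemma copositive_form N (M : 'M[R]_N) (x : 'cV[R]_N) :
  (x^T *m M *m x) 0 0 = frobenius_dot (x *m x^T) M.
Proof.
by rewrite /frobenius_dot trmx_mul trmxK -trace_mx11 mxtrace_mulC mulmxA.
Qed.

(** A factor of [G] splits it into the rank one terms of its nonnegative columns, so the pairing is
    a sum of values of the form [M] at these columns. *)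
Lemma frobenius_dot_copositive N (M G : 'M[R]_N) :
  copositive M -> completely_positive G -> 0 <= frobenius_dot G M.
Proof.
move=> [_ Mpos] [_ [k [B [/mxOverP B0 ->]]]].
have -> : B *m B^T = \sum_j col j B *m (col j B)^T.
  apply/matrixP => i l; rewrite mxE summxE; apply: eq_bigr => j _.
  by rewrite !mxE big_ord1 !mxE.
rewrite /frobenius_dot linear_sum mulmx_suml linear_sum.
apply: sumr_ge0 => j _; rewrite -[X in _ <= X]copositive_form.
by apply: Mpos; apply/mxOverP => i l; rewrite mxE.
Qed.

(* Normalizing the largest coefficient of a linear relation [c] between the
   rows to 1 and subtracting it from the unit weights kills that row. *)
Lemma conic_caratheodory_step k d (M : 'M[R]_(k, d)) : (d < k)%N ->
  exists w : 'rV[R]_k, [/\ w \is a mxOver Num.nneg, exists j, w 0 j = 0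
    & w *m M = const_mx 1 *m M].
Proof.
move=> ltdk.
(* With more rows than columns the left kernel is nonzero; replacing a relation by its opposite if
   necessary makes some coefficient positive. *)
have [c cM [i ci]] : exists2 c : 'rV[R]_k, c *m M = 0 & exists i, 0 < c 0 i.
  have : kermx M != 0.
    rewrite -mxrank_eq0 mxrank_ker subn_eq0 -ltnNge.
    exact: leq_ltn_trans (rank_leq_col M) ltdk.
  case/rowV0Pn => c /sub_kermxP cM /eqP c0.
  have /existsP[i ci] : [exists i, c 0 i != 0].
    apply/existsPn => c0'; apply: c0; apply/rowP => i.
    by rewrite mxE; apply/eqP; rewrite -[_ == _]negbK; exact: c0'.
  have [ci0|ci0|ci0] := ltrgtP (c 0 i) 0; last by rewrite ci0 eqxx in ci.
  - exists (- c); first by rewrite mulNmx cM oppr0.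
    by exists i; rewrite mxE oppr_gt0.
  - by exists c => //; exists i.
case: (@Order.TotalTheory.arg_maxP _ _ _ i predT (c 0) isT) => j _ cmax.
have cj : 0 < c 0 j by exact: lt_le_trans ci (cmax i isT).
exists (const_mx 1 - (c 0 j)^-1 *: c); split.
- apply/mxOverP => o l; rewrite ord1 !mxE nnegrE subr_ge0 mulrC.
  by rewrite ler_pdivrMr // mul1r; exact: cmax.
- by exists j; rewrite !mxE mulVf ?subrr // gt_eqF.
- by rewrite mulmxBl -scalemxAl cM scaler0 subr0.
Qed.

(* The rank one terms live in a space of dimension [N * N]. *)
Lemma completely_positive_caratheodory N k (B : 'M[R]_(N, k)) :
  B \is a mxOver Num.nneg ->
  exists C : 'M[R]_(N, N * N), C \is a mxOver Num.nneg /\ B *m B^T = C *m C^T.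
Proof.
elim: k B => [|k IH] B B0.
  exists 0; split; first by apply: mxOver0; rewrite nnegrE.
  by rewrite mul0mx; apply/matrixP => i j; rewrite !mxE big_ord0.
have [lek|ltk] := leqP k.+1 (N * N).
  (* A factor with few columns is padded with zero columns. *)
  exists (B *m pid_mx k.+1); split.
    apply: mxOverM => //; apply/mxOverP => i j.
    by rewrite mxE nnegrE ler0n.
  by rewrite trmx_mul tr_pid_mx mulmxA -(mulmxA B) pid_mx_id // pid_mx_1 mulmx1.
pose M : 'M[R]_(k.+1, N * N) :=
  \matrix_i mxvec (col i B *m (col i B)^T).
have [w [/mxOverP w0 [j wj] wM]] := conic_caratheodory_step M ltk.
(* The square roots of the new weights are absorbed into the columns, and column [j], of weight 0,
   is dropped. *)
pose C : 'M[R]_(N, k) :=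
  \matrix_(i, l) (Num.sqrt (w 0 (lift j l)) * B i (lift j l)).
have [|C' [C'0 CC']] := IH C.
  apply/mxOverP => i l; rewrite mxE nnegrE mulr_ge0 ?sqrtr_ge0 //.
  by have /mxOverP/(_ i (lift j l)) := B0; rewrite nnegrE.
exists C'; split=> //; rewrite -CC'; apply/matrixP => a b.
have /rowP/(_ (mxvec_index a b)) := wM.
have ME i : M i (mxvec_index a b) = B a i * B b i.
  by rewrite mxE mxvecE mxE big_ord1 !mxE.
rewrite !mxE (bigD1_ord j) //= wj mul0r add0r => wME.
rewrite [LHS](_ : _ =
  \sum_i const_mx 1 (0 : 'I_1) i * M i (mxvec_index a b)); last first.
  by apply: eq_bigr => i _; rewrite ME !mxE mul1r.
rewrite -wME; apply: eq_bigr => i _.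
rewrite ME !mxE mulrACA -expr2 sqr_sqrtr //.
by have := w0 0 (lift j i); rewrite nnegrE.
Qed.

End CompletelyPositive.

(** * Compactness and existence of a nearest point *)

Section NearestPoint.
Variable R : realType.

Lemma continuous_sumr (T : topologicalType) (I : finType) (F : I -> T -> R) :
  (forall i, continuous (F i)) -> continuous (fun t => \sum_i F i t).
Proof.
by move=> Fc; apply: continuous_big => //; exact: add_continuous.
Qed.

(** Factors are stored as row vectors because the extreme value theorem applied below is stated for
    these. *)
Lemma continuous_gram N k (a b : 'I_N) :
  continuous (fun v : 'rV[R]_(N * k) => (vec_mx v *m (vec_mx v)^T) a b).
Proof.
rewrite (_ : (fun _ => _) = fun v : 'rV[R]_(N * k) =>
  \sum_j v 0 (mxvec_index a j) * v 0 (mxvec_index b j)); last first.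
  by apply/funext => v; rewrite mxE; apply: eq_bigr => j _; rewrite !mxE.
apply: continuous_sumr => j v.
by apply: continuousM; exact: coord_continuous.
Qed.

Lemma mxtrace_gram m n (B : 'M[R]_(m, n)) :
  \tr (B *m B^T) = frobenius_dot B B.
Proof. by rewrite mxtrace_mulC. Qed.

Lemma frobenius_dot_ge_sqr m n (B : 'M[R]_(m, n)) i j :
  B i j ^+ 2 <= frobenius_dot B B.
Proof.
rewrite frobenius_dotE (bigD1 i) //= (bigD1 j) //= -expr2 -addrA lerDl.
rewrite addr_ge0 // sumr_ge0 // => k _; first exact: sqr_ge0.
by rewrite sumr_ge0 // => l _; exact: sqr_ge0.
Qed.

(** The trace of the Gram matrix is the sum of the squares of all entries of the factor, so bounding
    it bounds each entry; both constraints are closed. *)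
Lemma compact_gram N k (c : R) :
  compact [set v : 'rV[R]_(N * k) |
    vec_mx v \is a mxOver Num.nneg /\ \tr (vec_mx v *m (vec_mx v)^T) <= c].
Proof.
apply: bounded_closed_compact.
  (* From [x ^+ 2 <= c] follows [|x| <= 1 + c], which avoids a square root. *)
  exists (1 + c); split; first exact: num_real.
  move=> M ltM v [_ trc].
  rewrite /Num.norm /= mx_normrE; apply/bigmax_leP.
  have c0 : 0 <= c.
    by apply: le_trans trc; rewrite mxtrace_gram frobenius_dot_ge0.
  split=> [|[i j] _ /=]; first by lra.
  case/mxvec_indexP: j => a b; rewrite ord1.
  have := frobenius_dot_ge_sqr (vec_mx v) a b.
  rewrite -mxtrace_gram mxE => /le_trans/(_ trc) vc.
  suff : `|v 0 (mxvec_index a b)| <= 1 + c by lra.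
  rewrite -real_normK ?num_real // in vc.
  by have := normr_ge0 (v 0 (mxvec_index a b)); nra.
rewrite (_ : mkset _ =
  ([set v : 'rV[R]_(N * k) | \tr (vec_mx v *m (vec_mx v)^T) <= c] `&`
   \bigcap_ij [set v : 'rV[R]_(N * k) | 0 <= v 0 ij])%classic); last first.
  apply/seteqP; split=> v /=.
    case=> /mxOverP v0 trc; split=> // ij _ /=.
    by case/mxvec_indexP: ij => a b; have := v0 a b; rewrite mxE nnegrE.
  case=> trc v0; split=> //; apply/mxOverP => a b.
  by rewrite mxE nnegrE; exact: v0.
apply: closedI.
  apply: (@preimage_closed _ _
    (fun v : 'rV[R]_(N * k) => \tr (vec_mx v *m (vec_mx v)^T))
    [set x | x <= c]%classic); last exact: closed_le.
  by move=> v _; apply: continuous_sumr => a; exact: continuous_gram.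
apply: closed_bigI => ij _.
apply: (@preimage_closed _ _ (fun v : 'rV[R]_(N * k) => v 0 ij)
  [set x | 0 <= x]%classic); last exact: closed_ge.
by move=> v _; exact: coord_continuous.
Qed.

(** The minimum is taken over factors with [N * N] columns, a compact set; by Caratheodory every
    competitor [H] has such a factor. *)
Lemma completely_positive_nearest m n (A : 'M[R]_(m, n)) (c : R) : 0 <= c ->
  exists G : 'M[R]_(m + n), [/\ completely_positive G, \tr G <= c
    & forall H, completely_positive H -> \tr H <= c ->
      frobenius_dot (A - ursubmx G) (A - ursubmx G) <=
      frobenius_dot (A - ursubmx H) (A - ursubmx H)].
Proof.
move=> c0.
pose N := (m + n)%N; pose k := (N * N)%N.
pose gram (v : 'rV[R]_(N * k)) := vec_mx v *m (vec_mx v)^T.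
pose S := [set v : 'rV[R]_(N * k) |
  vec_mx v \is a mxOver Num.nneg /\ \tr (gram v) <= c]%classic.
have S0 : (S !=set0)%classic.
  exists 0; rewrite /S /gram /= linear0 mul0mx mxtrace0.
  by split=> //; apply: mxOver0; rewrite nnegrE.
pose f v := frobenius_dot (A - ursubmx (gram v)) (A - ursubmx (gram v)).
have fc : continuous f.
  rewrite (_ : f = fun v => \sum_i \sum_j
    (A i j - gram v (lshift n i) (rshift m j)) *
    (A i j - gram v (lshift n i) (rshift m j))); last first.
    apply/funext => v; rewrite /f frobenius_dotE.
    by apply: eq_bigr => i _; apply: eq_bigr => j _; rewrite !mxE.
  apply: continuous_sumr => i; apply: continuous_sumr => j v.
  have rc : {for v, continuous
      (fun v => A i j - gram v (lshift n i) (rshift m j))}.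
    by apply: continuousB; [exact: cst_continuous|exact: continuous_gram].
  exact: (continuousM rc rc).
have [|v] := @EVT_min_rV R _ f S S0 (@compact_gram N k c).
  exact: continuous_subspaceT.
rewrite inE => -[v0 vtr] fmin.
exists (gram v); split=> //; first exact: completely_positiveMtr.
move=> H [_ [l [B [B0 ->]]]] Htr.
have [C [C0 BC]] := completely_positive_caratheodory B0.
have := fmin (mxvec C); rewrite /f /gram mxvecK -BC; apply.
by rewrite inE /S /gram /= mxvecK -BC.
Qed.

End NearestPoint.

(** * Block matrices and weak duality *)

Section Duality.
Variables (R : realType) (m n : nat).
Implicit Types (A W : 'M[R]_(m, n)) (G H : 'M[R]_(m + n)).

Lemma frobenius_dot_delta k l (X : 'M[R]_(k, l)) a b :
  frobenius_dot (delta_mx a b) X = X a b.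
Proof.
rewrite frobenius_dotE (bigD1 a) //= (bigD1 b) //= mxE !eqxx mul1r.
rewrite !big1 ?addr0 // => [a' /negPf a'a|b' /negPf b'b].
  by rewrite big1 // => b' _; rewrite mxE a'a mul0r.
by rewrite mxE b'b andbF mul0r.
Qed.

Lemma frobenius_dot_block (X : 'M[R]_m) (Y : 'M[R]_n) A W :
  frobenius_dot (block_mx X A A^T Y) (block_mx 1%:M (- W) (- W^T) 1%:M) =
  \tr X + \tr Y - 2 * frobenius_dot A W.
Proof.
rewrite /frobenius_dot tr_block_mx mulmx_block mxtrace_block trmxK !mulmx1.
rewrite !mxtraceD !mxtrace_tr !mulmxN !linearN /=.
by rewrite -[\tr (A *m W^T)]mxtrace_tr trmx_mul trmxK mxtrace_mulC; ring.
Qed.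

Lemma completely_positive_block G : completely_positive G ->
  G = block_mx (ulsubmx G) (ursubmx G) (ursubmx G)^T (drsubmx G).
Proof.
move=> [+ _]; rewrite symmetricmxE => /eqP Gsym.
by rewrite trmx_ursub -Gsym submxK.
Qed.

Lemma copositive_block W :
  (forall (p : 'cV[R]_m) (q : 'cV[R]_n),
    p \is a mxOver Num.nneg -> q \is a mxOver Num.nneg ->
    2 * frobenius_dot (p *m q^T) W <= frobenius_dot p p + frobenius_dot q q) ->
  copositive (block_mx 1%:M (- W) (- W^T) 1%:M).
Proof.
move=> Wle; split.
  by rewrite symmetricmxE tr_block_mx !tr_scalar_mx !linearN /= trmxK.
move=> x /mxOverP x0; rewrite copositive_form -[x]vsubmxK tr_col_mx mul_col_row.
(* The lower left block must appear as the transpose of the upper right one for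
   [frobenius_dot_block] to match. *)
rewrite -[dsubmx x *m _]trmxK trmx_mul trmxK frobenius_dot_block subr_ge0.
rewrite !mxtrace_gram; apply: Wle; apply/mxOverP => i j; rewrite mxE; exact: x0.
Qed.

Lemma weak_duality W G :
  copositive (block_mx 1%:M (- W) (- W^T) 1%:M) -> completely_positive G ->
  2 * frobenius_dot (ursubmx G) W <= \tr G.
Proof.
move=> Wcop Gcp; have := frobenius_dot_copositive Wcop Gcp.
rewrite {1 3}(completely_positive_block Gcp) frobenius_dot_block mxtrace_block.
by rewrite subr_ge0.
Qed.

Lemma completely_positive_pair (p : 'cV[R]_m) (q : 'cV[R]_n) :
  p \is a mxOver Num.nneg -> q \is a mxOver Num.nneg ->
  exists G, [/\ completely_positive G, ursubmx G = p *m q^T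
    & \tr G = frobenius_dot p p + frobenius_dot q q].
Proof.
move=> p0 q0; exists (col_mx p q *m (col_mx p q)^T); split.
- exact/completely_positiveMtr/mxOver_col_mx.
- by rewrite tr_col_mx mul_col_row block_mxKur.
- by rewrite tr_col_mx mul_col_row mxtrace_block !mxtrace_gram.
Qed.

Lemma l2normE k (u : 'cV[R]_k) : l2norm u = Num.sqrt (frobenius_dot u u).
Proof.
rewrite /l2norm frobenius_dotE; congr Num.sqrt.
by apply: eq_bigr => i _; rewrite big_ord1 expr2.
Qed.

Lemma l2norm_ge0 k (u : 'cV[R]_k) : 0 <= l2norm u.
Proof. exact: sqrtr_ge0. Qed.

Lemma l2norm_eq0 k (u : 'cV[R]_k) : l2norm u = 0 -> u = 0.
Proof.
rewrite l2normE => /eqP; rewrite sqrtr_eq0 => u0; apply: frobenius_dot_eq0.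
by apply/eqP; rewrite eq_le u0 frobenius_dot_ge0.
Qed.

Lemma sqr_l2norm k (u : 'cV[R]_k) : l2norm u ^+ 2 = frobenius_dot u u.
Proof. by rewrite l2normE sqr_sqrtr // frobenius_dot_ge0. Qed.

(* The copositivity inequality is tight for balanced vectors, so it is applied
   to [|q| p] and [|p| q]. *)
Lemma copositive_block_norm W (p : 'cV[R]_m) (q : 'cV[R]_n) :
  copositive (block_mx 1%:M (- W) (- W^T) 1%:M) ->
  p \is a mxOver Num.nneg -> q \is a mxOver Num.nneg ->
  frobenius_dot (p *m q^T) W <= l2norm p * l2norm q.
Proof.
move=> Wcop p0 q0.
(* The rescaled inequality carries the factor [l2norm p * l2norm q], which has to be cancelled; a
   vector of norm 0 is therefore treated apart. *)
have [/l2norm_eq0 ->|pn0] := eqVneq (l2norm p) 0.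
  rewrite mul0mx frobenius_dotC /frobenius_dot mulmx0 mxtrace0.
  by rewrite mulr_ge0 ?l2norm_ge0.
have [/l2norm_eq0 ->|qn0] := eqVneq (l2norm q) 0.
  rewrite trmx0 mulmx0 frobenius_dotC /frobenius_dot mulmx0 mxtrace0.
  by rewrite mulr_ge0 ?l2norm_ge0.
have pq0 : 0 < l2norm p * l2norm q.
  by rewrite mulr_gt0 // lt_neqAle eq_sym ?pn0 ?qn0 l2norm_ge0.
have [||G [Gcp Gur Gtr]] :=
    @completely_positive_pair (l2norm q *: p) (l2norm p *: q).
- by rewrite mxOverZ // nnegrE l2norm_ge0.
- by rewrite mxOverZ // nnegrE l2norm_ge0.
have := weak_duality Wcop Gcp.
rewrite Gur Gtr linearZ /= -scalemxAl -scalemxAr scalerA.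
rewrite frobenius_dotC !frobenius_dotZr [frobenius_dot W _]frobenius_dotC.
rewrite ![frobenius_dot (_ *: _) _]frobenius_dotC !frobenius_dotZr -!sqr_l2norm.
by move=> pq_le; rewrite -(ler_pM2l pq0); lra.
Qed.

(** * Finiteness and positivity of [nu_plus] *)

Lemma copositive_entry W i j :
  copositive (block_mx 1%:M (- W) (- W^T) 1%:M) -> W i j <= 1.
Proof.
move=> Wcop.
have delta0 k (a : 'I_k) : (delta_mx a 0 : 'cV[R]_k) \is a mxOver Num.nneg.
  by apply/mxOverP => x y; rewrite mxE nnegrE ler0n.
have := copositive_block_norm Wcop (delta0 _ i) (delta0 _ j).
rewrite trmx_delta mul_delta_mx frobenius_dot_delta !l2normE.
by rewrite !frobenius_dot_delta !mxE !eqxx sqrtr1 mulr1.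
Qed.

(** Feasibility bounds the entries of [W] from above only; nonnegativity of [A] turns this into a
    bound on the objective. *)
Lemma frobenius_dot_le_entries A W : A \is a mxOver Num.nneg ->
  copositive (block_mx 1%:M (- W) (- W^T) 1%:M) ->
  frobenius_dot A W <= \sum_i \sum_j A i j.
Proof.
move=> /mxOverP A0 Wcop; rewrite frobenius_dotE.
apply: ler_sum => i _; apply: ler_sum => j _.
rewrite -[X in _ <= X]mulr1; apply: ler_wpM2l; last exact: copositive_entry.
by have := A0 i j; rewrite nnegrE.
Qed.

Lemma copositive_block0 :
  copositive (block_mx 1%:M (- (0 : 'M[R]_(m, n))) (- 0^T) 1%:M).
Proof.
apply: copositive_block => p q _ _.
rewrite /frobenius_dot mulmx0 mxtrace0 mulr0.
by rewrite addr_ge0 // frobenius_dot_ge0.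
Qed.

Lemma has_sup_copositive_values A :
  A \is a mxOver Num.nneg -> has_sup (copositive_values A).
Proof.
move=> A0; split.
  by exists (frobenius_dot A 0), 0 => //; exact: copositive_block0.
exists (\sum_i \sum_j A i j) => _ [W Wcop <-].
exact: frobenius_dot_le_entries.
Qed.

Lemma nu_plus_ge A W : A \is a mxOver Num.nneg ->
  copositive (block_mx 1%:M (- W) (- W^T) 1%:M) ->
  frobenius_dot A W <= nu_plus A.
Proof.
move=> A0 Wcop; apply: ub_le_sup; last by exists W.
by have [] := has_sup_copositive_values A0.
Qed.

Lemma nu_plus_ge0 A : A \is a mxOver Num.nneg -> 0 <= nu_plus A.
Proof.
move=> A0; have := nu_plus_ge A0 copositive_block0.
by rewrite /frobenius_dot mulmx0 mxtrace0.
Qed.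

(** This is [2 * p_i * q_j <= p_i ^+ 2 + q_j ^+ 2]. These feasible points read off the entries of
    [A], so that [nu_plus A = 0] forces [A = 0]. *)
Lemma copositive_block_delta i j :
  copositive (block_mx 1%:M (- (delta_mx i j : 'M[R]_(m, n)))
                       (- (delta_mx i j)^T) 1%:M).
Proof.
apply: copositive_block => p q _ _.
rewrite frobenius_dotC frobenius_dot_delta mxE big_ord1 mxE.
have := frobenius_dot_ge_sqr p i 0.
have := frobenius_dot_ge_sqr q j 0.
by have := sqr_ge0 (p i 0 - q j 0); lra.
Qed.

Lemma nu_plus_eq0 A : A \is a mxOver Num.nneg -> nu_plus A = 0 -> A = 0.
Proof.
move=> A0 nu0; apply/matrixP => i j; rewrite mxE; apply/eqP.
have := nu_plus_ge A0 (copositive_block_delta i j).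
have /mxOverP/(_ i j) := A0; rewrite nnegrE eq_le nu0 => ->.
by rewrite andbT frobenius_dotC frobenius_dot_delta.
Qed.

(** * Variational inequality and strong duality *)

Lemma frobenius_dot_subZ (P D : 'M[R]_(m, n)) s :
  frobenius_dot (P - s *: D) (P - s *: D) =
  frobenius_dot P P - 2 * s * frobenius_dot P D + s ^+ 2 * frobenius_dot D D.
Proof.
rewrite frobenius_dotBr frobenius_dotZr !(frobenius_dotC (P - _)).
by rewrite !frobenius_dotBr !frobenius_dotZr (frobenius_dotC D P); ring.
Qed.

(** Moving from [G] a fraction [s] of the way to [H] stays feasible by convexity, so the first order
    change of the squared distance cannot be negative. *)
Lemma nearest_variational A (c : R) G :
  completely_positive G -> \tr G <= c ->
  (forall H, completely_positive H -> \tr H <= c ->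
    frobenius_dot (A - ursubmx G) (A - ursubmx G) <=
    frobenius_dot (A - ursubmx H) (A - ursubmx H)) ->
  forall H, completely_positive H -> \tr H <= c ->
    frobenius_dot (A - ursubmx G) (ursubmx H - ursubmx G) <= 0.
Proof.
move=> Gcp Gtr Gmin H Hcp Htr.
set P := A - ursubmx G; set D := ursubmx H - ursubmx G.
have step s : 0 <= s <= 1 ->
    2 * s * frobenius_dot P D <= s ^+ 2 * frobenius_dot D D.
  move=> /andP[s0 s1].
  have := Gmin ((1 - s) *: G + s *: H).
  have -> : A - ursubmx ((1 - s) *: G + s *: H) = P - s *: D.
    by apply/matrixP => i j; rewrite !mxE; ring.
  rewrite frobenius_dot_subZ.
  rewrite -/P => PD.
  suff : frobenius_dot P P <= frobenius_dot P P - 2 * s * frobenius_dot P D +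
    s ^+ 2 * frobenius_dot D D by lra.
  apply: PD.
    by apply: completely_positiveD; apply: completely_positiveZ => //; lra.
  rewrite mxtraceD !mxtraceZ; nra.
rewrite leNgt; apply/negP => PD0.
have DD0 := frobenius_dot_ge0 D.
set x := frobenius_dot P D in step PD0; set y := frobenius_dot D D in step DD0.
have xy : 0 < x + y by lra.
(* Cancelling [s] in [step] leaves [2 * x <= s * y], while this choice gives
   [s * y = x - s * x < 2 * x]. *)
pose s := x / (x + y).
have s0 : 0 < s by rewrite divr_gt0.
have s1 : s <= 1 by rewrite ler_pdivrMr // mul1r; lra.
have sxy : s * (x + y) = x by rewrite divfK // gt_eqF.
have := step s; rewrite (ltW s0) s1 => /(_ isT).
rewrite expr2 -mulrA mulrCA -mulrA ler_pM2l //; nra.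
Qed.
Lemma ursubmxZ a G : ursubmx (a *: G) = a *: ursubmx G.
Proof. by apply/matrixP => i j; rewrite !mxE. Qed.

Lemma ursubmx0 : ursubmx (0 : 'M[R]_(m + n)) = 0.
Proof. by rewrite -(scale0r (0 : 'M_(_))) ursubmxZ scale0r. Qed.

(** The rank one matrix of the stacked vector is rescaled to trace [2 * nu], which makes the bound
    homogeneous in [p] and [q]. *)
Lemma scaled_form_le (P : 'M[R]_(m, n)) (nu c : R) : 0 < nu ->
  (forall H, completely_positive H -> \tr H <= 2 * nu ->
    frobenius_dot P (ursubmx H) <= c) ->
  forall (p : 'cV[R]_m) (q : 'cV[R]_n),
    p \is a mxOver Num.nneg -> q \is a mxOver Num.nneg ->
    2 * nu * frobenius_dot P (p *m q^T) <=
    c * (frobenius_dot p p + frobenius_dot q q).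
Proof.
move=> nu0 Ple p q p0 q0.
have [H [Hcp Hur Htr]] := completely_positive_pair p0 q0.
have [pp0 qq0] := (frobenius_dot_ge0 p, frobenius_dot_ge0 q).
(* Trace 0 cannot be rescaled; it means [p = 0] and [q = 0]. *)
have [t0|t0] := eqVneq (frobenius_dot p p + frobenius_dot q q) 0.
  have -> : p = 0 by apply: frobenius_dot_eq0; lra.
  rewrite mul0mx {1}/frobenius_dot mulmx0 mxtrace0 mulr0.
  rewrite frobenius_dotE big1 => [|i _]; last first.
    by rewrite big1 // => j _; rewrite mxE mul0r.
  by rewrite (_ : frobenius_dot q q = 0) ?addr0 ?mulr0 //; lra.
rewrite -Hur -Htr in t0 *.
have tpos : 0 < \tr H by rewrite lt_neqAle eq_sym t0 Htr addr_ge0.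
have sHcp : completely_positive (2 * nu / \tr H *: H).
  by apply: completely_positiveZ => //; rewrite divr_ge0 // ltW // mulr_gt0.
have := Ple _ sHcp; rewrite mxtraceZ divfK // lexx => /(_ isT).
by rewrite ursubmxZ frobenius_dotZr mulrAC ler_pdivrMr.
Qed.

Lemma strong_duality A : A \is a mxOver Num.nneg ->
  exists G, [/\ completely_positive G, ursubmx G = A & \tr G <= 2 * nu_plus A].
Proof.
move=> A0; have := nu_plus_ge0 A0; rewrite le_eqVlt eq_sym.
(* The multiple of [P] built below has coefficient [nu_plus A / d], which yields no contradiction
   when [nu_plus A = 0]. *)
case/predU1P => [nu0|nu_gt0].
  exists 0; rewrite nu0 (nu_plus_eq0 A0 nu0) mulr0 mxtrace0.
  by split; [exact: completely_positive0|exact: ursubmx0|].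
have nu2 : 0 <= 2 * nu_plus A by lra.
have [G [Gcp Gtr Gmin]] := completely_positive_nearest A nu2.
exists G; split=> //.
have Gvar := nearest_variational Gcp Gtr Gmin.
set P := A - ursubmx G in Gvar.
pose c := frobenius_dot P (ursubmx G).
have Pc H : completely_positive H -> \tr H <= 2 * nu_plus A ->
    frobenius_dot P (ursubmx H) <= c.
  by move=> Hcp Htr; have := Gvar H Hcp Htr; rewrite frobenius_dotBr subr_le0.
have c0 : 0 <= c.
  have := Pc 0 (completely_positive0 _ _).
  by rewrite mxtrace0 ursubmx0 {1}/frobenius_dot mulmx0 mxtrace0; apply.
have AP : frobenius_dot A P = c + frobenius_dot P P.
  rewrite -[A](subrK (ursubmx G)) -/P frobenius_dotC frobenius_dotDr.
  by rewrite addrC.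
have P_ge0 := frobenius_dot_ge0 P.
suff PP0 : frobenius_dot P P = 0.
  by apply/esym/eqP; rewrite -subr_eq0; apply/eqP/frobenius_dot_eq0.
apply/eqP; rewrite eq_le P_ge0 andbT leNgt; apply/negP => P_gt0.
(* Any [d] strictly between [c] and [frobenius_dot A P] would do: [c <= d] makes
   [nu_plus A / d *: P] feasible, and [d < frobenius_dot A P] makes its value exceed [nu_plus A]. *)
pose d := c + frobenius_dot P P / 2.
have d0 : 0 < d by rewrite /d; lra.
have Wcop : copositive
    (block_mx 1%:M (- (nu_plus A / d *: P)) (- (nu_plus A / d *: P)^T) 1%:M).
  apply: copositive_block => p q p0 q0.
  have := scaled_form_le nu_gt0 Pc p0 q0.
  have := frobenius_dot_ge0 p; have := frobenius_dot_ge0 q.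
  rewrite frobenius_dotZr (frobenius_dotC _ P).
  set t := frobenius_dot P _; set x := frobenius_dot p p.
  set y := frobenius_dot q q => y0 x0 le_t.
  rewrite mulrA mulrA mulrAC ler_pdivrMr //.
  have : 0 <= (d - c) * (x + y) by rewrite mulr_ge0 // /d; lra.
  lra.
have := nu_plus_ge A0 Wcop.
rewrite frobenius_dotZr AP mulrAC ler_pdivrMr // ler_pM2l // /d; lra.
Qed.

(* AM-GM on each column of a factor compares the objectives of (i) and (ii). *)
Lemma decomposition_of_completely_positive G : completely_positive G ->
  exists2 c, decomposition_values (ursubmx G) c & 2 * c <= \tr G.
Proof.
move=> [_ [k [B [/mxOverP B0 ->]]]].
rewrite -[B]vsubmxK tr_col_mx mul_col_row block_mxKur mxtrace_block.
set U := usubmx B; set V := dsubmx B.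
have sqE l (C : 'M[R]_(l, k)) : \tr (C *m C^T) = \sum_j l2norm (col j C) ^+ 2.
  rewrite mxtrace_gram frobenius_dotE exchange_big; apply: eq_bigr => j _.
  rewrite sqr_l2norm frobenius_dotE; apply: eq_bigr => i _.
  by rewrite big_ord1 !mxE.
exists (\sum_j l2norm (col j U) * l2norm (col j V)).
  exists k, (fun j => col j U), (fun j => col j V); split=> //.
  - by move=> j; apply/mxOverP => a b; rewrite !mxE.
  - by move=> j; apply/mxOverP => a b; rewrite !mxE.
  - apply/matrixP => a b; rewrite mxE summxE; apply: eq_bigr => j _.
    by rewrite !mxE big_ord1 !mxE.
rewrite !sqE mulr_sumr -big_split /=; apply: ler_sum => j _.
have := sqr_ge0 (l2norm (col j U) - l2norm (col j V)); lra.
Qed.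

(** * Lower bounds and attainment of both minima *)

Lemma decomposition_values_ge A : A \is a mxOver Num.nneg ->
  lbound (decomposition_values A) (nu_plus A).
Proof.
move=> A0 _ [k [u [v [u0 v0 AE ->]]]].
apply: ge_sup; first by have [] := has_sup_copositive_values A0.
move=> _ [W Wcop <-].
rewrite AE /frobenius_dot linear_sum mulmx_suml linear_sum.
by apply: ler_sum => i _; exact: copositive_block_norm.
Qed.

Lemma completely_positive_values_ge A : A \is a mxOver Num.nneg ->
  lbound (completely_positive_values A) (nu_plus A).
Proof.
move=> A0 _ [X [Y [_ _ Gcp ->]]].
apply: ge_sup; first by have [] := has_sup_copositive_values A0.
move=> _ [W Wcop <-]; have := weak_duality Wcop Gcp.
by rewrite block_mxKur mxtrace_block; lra.
Qed.

End Duality.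

Theorem theorem4 (R : realType) (m n : nat) (A : 'M[R]_(m, n))
    (hA : A \is a mxOver Num.nneg) :
  [/\ has_sup (copositive_values A),
      is_min (decomposition_values A) (nu_plus A)
    & is_min (completely_positive_values A) (nu_plus A)].
Proof.
have dec_ge := decomposition_values_ge hA.
have cp_ge := completely_positive_values_ge hA.
have [G [Gcp Gur Gtr]] := strong_duality hA.
split; first exact: has_sup_copositive_values.
  split=> //.
  (* Here [2 * c <= \tr G <= 2 * nu_plus A], and the lower bound [dec_ge] forces equality. *)
  have [c Ac cG] := decomposition_of_completely_positive Gcp.
  rewrite Gur in Ac; rewrite (_ : nu_plus A = c) //.
  by have := dec_ge c Ac; lra.
split=> //.
(* The diagonal blocks of the same [G] serve as [X] and [Y]. *)
have Gvalue : completely_positive_values A (2^-1 * \tr G).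
  have GE := completely_positive_block Gcp; rewrite Gur in GE.
  exists (ulsubmx G), (drsubmx G).
  have [+ _] := Gcp; rewrite symmetricmxE => /eqP Gsym.
  split; rewrite -?GE //.
  - by rewrite symmetricmxE trmx_ulsub -Gsym.
  - by rewrite symmetricmxE trmx_drsub -Gsym.
  - by rewrite {1}GE mxtrace_block.
rewrite (_ : nu_plus A = 2^-1 * \tr G) //.
by have := cp_ge _ Gvalue; lra.
Qed.
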